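(* Let $\lambda>-1$ and $t\in\mathbb{R}$, and let $\{S_n(x;t)\}_{n=0}^{\infty}$ be the monic orthogonal polynomials with respect to the generalized Freud weight $w(x;t)=|x|^{2\lambda+1}\exp(-x^4+tx^2)$ on $\mathbb{R}$, with recurrence coefficients $\beta_n(t;\lambda)$ in $$xS_n(x;t)=S_{n+1}(x;t)+\beta_n(t;\lambda)S_{n-1}(x;t),\qquad S_{-1}(x;t)=0,\ S_0(x;t)=1 .$$ Then, for $n\ge 0$, $$\beta_{2n}(t;\lambda)=\frac{d}{dt}\ln\frac{\tau_n(t;\lambda+1)}{\tau_n(t;\lambda)},\qquad \beta_{2n+1}(t;\lambda)=\frac{d}{dt}\ln\frac{\tau_{n+1}(t;\lambda)}{\tau_n(t;\lambda+1)},$$ where $\tau_n(t;\lambda)$ is the Wronskian $$\tau_n(t;\lambda)=\mathcal{W}\left(\phi_\lambda,\frac{d\phi_\lambda}{dt},\ldots,\frac{d^{n-1}\phi_\lambda}{dt^{n-1}}\right),$$ with $$\phi_\lambda(t)=\int_{-\infty}^{\infty}|x|^{2\lambda+1}\exp(-x^4+tx^2)\,dx=\frac{\Gamma(\lambda+1)}{2^{(\lambda+1)/2}}\exp\left(\tfrac18t^2\right)D_{-\lambda-1}\left(-\tfrac12\sqrt2\,t\right).$$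
   Context: $\mathcal{W}(f_1,\dots,f_n)$ is the Wronskian determinant with respect to $t$, i.e. $\tau_n(t;\lambda)=\det\left[\frac{d^{j+k}\phi_\lambda}{dt^{j+k}}\right]_{j,k=0}^{n-1}$, with the convention $\tau_0(t;\lambda)=1$; $\beta_0(t;\lambda)=0$. $D_\nu$ is the parabolic cylinder function, with integral representation $D_\nu(\xi)=\frac{\exp(-\xi^2/4)}{\Gamma(-\nu)}\int_0^\infty s^{-\nu-1}\exp(-\tfrac12s^2-\xi s)\,ds$ for $\Re(\nu)<0$. Orthogonality means $\int_{-\infty}^\infty S_n(x;t)S_m(x;t)w(x;t)\,dx=h_n\delta_{mn}$ with $h_n>0$. *)

(* Defs.v *)
From HB Require Import structures.
From mathcomp Require Import all_boot all_order all_algebra.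
From mathcomp Require Import all_classical all_reals all_analysis.

Set Implicit Arguments.
Unset Strict Implicit.
Unset Printing Implicit Defensive.

Import Order.TTheory GRing.Theory Num.Theory.
Import numFieldNormedType.Exports.

Local Open Scope classical_set_scope.
Local Open Scope ring_scope.

Definition freud_weight (R : realType) (lam t x : R) : R :=
  `|x| `^ (2 * lam + 1) * expR (- x ^+ 4 + t * x ^+ 2).

Definition freud_phi (R : realType) (lam t : R) : R :=
  \int[@lebesgue_measure R]_x freud_weight lam t x.

(* Column [k] holds [f k], row [j] the [j]-th derivatives. *)
Definition wronskian (R : realType) (n : nat) (f : 'I_n -> R -> R) (t : R) : R :=
  \det (\matrix_(j < n, k < n) derive1n j (f k) t).

(* For [n = 0] this is the determinant of the empty matrix, that is, 1. *)
Definition freud_tau (R : realType) (n : nat) (lam t : R) : R :=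
  wronskian (fun k : 'I_n => derive1n k (freud_phi lam)) t.

Definition monic_orthogonal_polys (R : realType) (w : R -> R)
    (S : nat -> {poly R}) : Prop :=
  (forall n, S n \is monic /\ size (S n) = n.+1) /\
  exists h : nat -> R,
    (forall n, 0 < h n) /\
    forall m n, \int[@lebesgue_measure R]_x ((S n).[x] * (S m).[x] * w x)
                = h n * (m == n)%:R.

(* [poly_pred S n] is S_(n-1), with S_(-1) = 0. *)
Definition poly_pred (R : realType) (S : nat -> {poly R}) (n : nat) : {poly R} :=
  if n is m.+1 then S m else 0.

(* Euler's integral: the Gamma function for 0 < z only. *)
Definition euler_gamma (R : realType) (z : R) : R :=
  \int[@lebesgue_measure R]_(s in `]0, +oo[) (s `^ (z - 1) * expR (- s)).

(* The integral representation of the parabolic cylinder function D_nu(xi),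
   valid for nu < 0 only. *)
Definition parabolic_cylinder (R : realType) (nu xi : R) : R :=
  expR (- (xi ^+ 2) / 4) / euler_gamma (- nu) *
  \int[@lebesgue_measure R]_(s in `]0, +oo[)
    (s `^ (- nu - 1) * expR (- (s ^+ 2 / 2) - xi * s)).

(* Main.v *)
Require Import Defs.
From HB Require Import structures.
From mathcomp Require Import all_boot all_order all_algebra.
From mathcomp Require Import all_classical all_reals all_analysis.
From mathcomp Require Import measurable_realfun.
From mathcomp Require Import perm ring lra.

Set Implicit Arguments.
Unset Strict Implicit.
Unset Printing Implicit Defensive.

Import Order.TTheory GRing.Theory Num.Theory.
Import numFieldNormedType.Exports.

Local Open Scope classical_set_scope.
Local Open Scope ring_scope.

(** Differentiating under the integral sign turns [freud_phi lam] into
    [freud_phi (lam + 1)], so [freud_tau n lam] is the [n x n] Hankel determinant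
    of the sequence [k |-> freud_phi (lam + k)]; these are the moments of the
    weight [y ^ lam * exp (- y ^ 2 + t y)] on the half line, once [y = x ^ 2].
    The three-term recurrence without diagonal term forces [S_n] to have the
    parity of [n], so that [S_(2n) = P_n(x^2)] and [S_(2n+1) = x Q_n(x^2)], where
    the monic [P_n] are orthogonal for the parameter [lam] and the monic [Q_n] for
    the parameter [lam + 1].

    Two facts on Hankel matrices of moments [mu_k], with monic orthogonal
    polynomials [P_n] of squared norms [g_n], then suffice.  If [L] is the unit
    triangular matrix of coefficients of the [P_n], orthogonality says
    [L H L^T = diag g], so [det H] is the product of the [g_i] and is positive
    ([det_hankel_orthogonal]).  If moreover [mu_k' = mu_(k+1)] along a parameter
    [t], differentiating a row of [H] yields the next row; hence only the last row
    contributes to the derivative of [det H], and the orthogonality relations of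
    [P_n] express the shifted last row through the rows of [H]:
    [(ln det H)' = - p_n], with [p_n] the coefficient of degree [n - 1] in [P_n]
    ([is_derive_det_hankel]).

    Comparing subleading coefficients in the recurrence gives
    [beta_(2n) = p_n - q_n] and [beta_(2n+1) = q_n - p_(n+1)]
    ([beta_even], [beta_odd]), which are the announced logarithmic derivatives.

    The closed form of [freud_phi] is the substitution [s = sqrt 2 * x ^ 2]
    in the integral defining the parabolic cylinder function; since the integrands
    may be unbounded at [0], it is carried out on [c, +oo[ and [c] is sent to [0].
    Every convergence claim is reduced to that of the Gamma integral. *)

(** * Derivative of a determinant *)

Lemma is_derive_bigsum (R : realType) (I : Type) (r : seq I) (h : I -> R -> R)
    (dh : I -> R) (t : R) :
  (forall i, is_derive t 1 (h i) (dh i)) ->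
  is_derive t 1 (fun s => \sum_(i <- r) h i s) (\sum_(i <- r) dh i).
Proof.
move=> hd; elim: r => [|i r IH].
  rewrite big_nil (_ : (fun _ => _) = cst 0); first exact: is_derive_cst.
  by apply/funext => s; rewrite big_nil.
rewrite big_cons.
rewrite (_ : (fun _ => _) = h i \+ (fun s => \sum_(i <- r) h i s)).
  exact: is_deriveD.
by apply/funext => s; rewrite big_cons.
Qed.

Lemma is_derive_bigprod (R : realType) (I : eqType) (r : seq I)
    (h : I -> R -> R) (dh : I -> R) (t : R) : uniq r ->
  (forall i, is_derive t 1 (h i) (dh i)) ->
  is_derive t 1 (fun s => \prod_(i <- r) h i s)
    (\sum_(k <- r) \prod_(i <- r) (if i == k then dh i else h i t)).
Proof.
move=> ur hd; elim: r ur => [_|a r IH /= /andP[ar ur]].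
  rewrite big_nil (_ : (fun _ => _) = cst 1); first exact: is_derive_cst.
  by apply/funext => s; rewrite big_nil.
rewrite (_ : (fun _ => _) = h a \* (fun s => \prod_(i <- r) h i s)); last first.
  by apply/funext => s; rewrite big_cons.
have := is_deriveM (hd a) (IH ur); move/is_derive_eq; apply.
rewrite big_cons big_cons eqxx addrC; congr (_ + _).
  rewrite -[LHS]/(_ * _) mulrC; congr (_ * _).
  by apply: eq_big_seq => i ir; case: eqP => // ia; rewrite -ia ir in ar.
rewrite -[LHS]/(_ * _) mulr_sumr; apply: eq_big_seq => k kr.
by rewrite big_cons; case: eqP => // ak; rewrite ak kr in ar.
Qed.

(** Row-wise Leibniz rule: rows rather than columns, because it is then applied
    to Hankel matrices through [determinant_alternate]. *)
Lemma is_derive_det (R : realType) (n : nat) (M : R -> 'M[R]_n) (dM : 'M[R]_n)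
    (t : R) :
  (forall i j, is_derive t 1 (fun s => M s i j) (dM i j)) ->
  is_derive t 1 (fun s => \det (M s))
    (\sum_k \det (\matrix_(i, j) (if i == k then dM i j else M t i j))).
Proof.
move=> hd; rewrite /determinant.
pose dprod (p : 'S_n) :=
  \sum_k \prod_i (if i == k then dM i (p i) else M t i (p i)).
have dp (p : 'S_n) :
    is_derive t 1 (fun s => (-1) ^+ p * \prod_i M s i (p i)) ((-1) ^+ p * dprod p).
  rewrite (_ : (fun _ => _) = (-1) ^+ p \*: (fun s => \prod_i M s i (p i))) //.
  apply: is_deriveZ; apply: is_derive_bigprod; exact: index_enum_uniq.
have := is_derive_bigsum (index_enum _) dp; move/is_derive_eq; apply.
rewrite exchange_big /=; apply: eq_bigr => p _.
rewrite /dprod mulr_sumr; apply: eq_bigr => k _; congr (_ * _).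
by apply: eq_bigr => i _; rewrite mxE.
Qed.

(** * Hankel determinants and orthogonal polynomials *)

Definition hankel (R : realType) (mu : nat -> R) (n : nat) : 'M[R]_n :=
  \matrix_(i, j) mu (i + j)%N.

Section HankelOrthogonal.
Variables (R : realType) (mu : nat -> R) (P : nat -> {poly R}) (g : nat -> R).
Hypothesis P_monic : forall n, P n \is monic.
Hypothesis size_P : forall n, size (P n) = n.+1.
Hypothesis P_orth : forall m n,
  \sum_(k < m.+1) \sum_(l < n.+1) (P m)`_k * (P n)`_l * mu (k + l)%N
  = g m * (m == n)%:R.

Let P_lead n : (P n)`_n = 1.
Proof. by have /monicP := P_monic n; rewrite /lead_coef size_P. Qed.

Let P_big n k : (n < k)%N -> (P n)`_k = 0.
Proof. by move=> nk; rewrite nth_default// size_P. Qed.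

Let L n : 'M[R]_n := \matrix_(i, j) (P i)`_j.

(* [P k] has degree [k], so a sum over all indices below [n] stops at [k]. *)
Let widen_coef_sum n (k : 'I_n) (F : nat -> R) :
  \sum_(i < n) (P k)`_i * F i = \sum_(i < k.+1) (P k)`_i * F i.
Proof.
rewrite (big_ord_widen _ (fun i => (P k)`_i * F i) (ltn_ord k)) [RHS]big_mkcond /=.
by apply: eq_bigr => i _; rewrite ltnS; case: leqP => // ki; rewrite P_big// mul0r.
Qed.

Let det_L n : \det (L n) = 1.
Proof.
rewrite det_trig; last by apply/is_trig_mxP => i j ij; rewrite mxE P_big.
by rewrite big1// => i _; rewrite mxE P_lead.
Qed.

(** The Gram matrix of the [P i] is [L H L^T] with [L] unit triangular, and
    orthogonality makes it diagonal. *)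
Lemma det_hankel_orthogonal n : \det (hankel mu n) = \prod_(i < n) g i.
Proof.
have E : L n *m hankel mu n *m (L n)^T = diag_mx (\row_i g i).
  apply/matrixP => i j; rewrite !mxE.
  have -> : g i *+ (i == j) = g i * ((i : nat) == j)%:R by rewrite mulr_natr.
  transitivity (\sum_(l < n) (P j)`_l *
      \sum_(k < i.+1) (P i)`_k * mu (k + l)%N).
    apply: eq_bigr => l _; rewrite mxE mulrC mxE [in LHS]mxE; congr (_ * _).
    under eq_bigr do rewrite !mxE.
    exact: (widen_coef_sum i (fun k => mu (k + l)%N)).
  rewrite (widen_coef_sum j
    (fun l => \sum_(k < i.+1) (P i)`_k * mu (k + l)%N)).
  rewrite -P_orth exchange_big /=; apply: eq_bigr => l _.
  by rewrite mulr_sumr; apply: eq_bigr => k _; rewrite mulrCA mulrA.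
have := congr1 determinant E.
rewrite !det_mulmx det_tr det_L mul1r mulr1 det_diag => ->.
by apply: eq_bigr => i _; rewrite mxE.
Qed.

(** [P n] is orthogonal to the monomials of degree less than [n]: these pairings
    form a vector killed by the invertible matrix [L n]. *)
Lemma hankel_orthogonal_row n (j : 'I_n) : \sum_(i < n.+1) (P n)`_i * mu (i + j)%N = 0.
Proof.
pose v : 'cV[R]_n := \col_j \sum_(i < n.+1) (P n)`_i * mu (i + j)%N.
have Lv : L n *m v = 0.
  apply/matrixP => k z; rewrite !mxE.
  under eq_bigr do rewrite !mxE.
  rewrite (widen_coef_sum k (fun l => \sum_(i < n.+1) (P n)`_i * mu (i + l)%N)).
  transitivity (g k * ((k : nat) == n)%:R); last by rewrite ltn_eqF// mulr0.
  rewrite -P_orth; apply: eq_bigr => l _; rewrite mulr_sumr.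
  by apply: eq_bigr => i _; rewrite mulrA addnC.
have Lu : L n \in unitmx by rewrite unitmxE det_L unitr1.
have v0 : v = 0 by rewrite -(mulKmx Lu v) Lv mulmx0.
by move/matrixP : v0 => /(_ j ord0); rewrite !mxE.
Qed.

(** The relations [hankel_orthogonal_row] for [P n.+1] write the moved last row as
    minus the combination of the rows of the Hankel matrix with the lower
    coefficients of [P n.+1]. *)
Lemma det_hankel_last_shift n :
  \det (\matrix_(i < n.+1, j < n.+1) mu (i + j + (i == n :> nat))%N) =
  - (P n.+1)`_n * \det (hankel mu n.+1).
Proof.
(* Left multiplication by [C] replaces the last row by that combination. *)
pose C : 'M[R]_n.+1 := \matrix_(i, j)
  if i == ord_max then - (P n.+1)`_j else (i == j)%:R.
have detC : \det C = - (P n.+1)`_n.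
  rewrite det_trig.
    rewrite big_ord_recr /= mxE eqxx big1 ?mul1r// => i _; rewrite mxE eqxx.
    by rewrite ifF//; apply/negbTE; rewrite -val_eqE /= ltn_eqF.
  apply/is_trig_mxP => i j ij; rewrite mxE ifF.
    by rewrite -val_eqE ltn_eqF.
  apply/negbTE; rewrite -val_eqE /= ltn_eqF//.
  by rewrite (leq_trans ij)// -ltnS.
rewrite -detC -det_mulmx; congr (\det _); apply/matrixP => i j; rewrite !mxE.
have [->|ni] := eqVneq i ord_max.
  under eq_bigr do rewrite !mxE eqxx mulNr.
  rewrite sumrN /= eqxx addn1 -addSn.
  have := hankel_orthogonal_row j; rewrite big_ord_recr /= P_lead mul1r.
  by move/eqP; rewrite addr_eq0 => /eqP ->; rewrite opprK.
rewrite (bigD1 i)//= !mxE (negbTE ni) eqxx mul1r big1 ?addr0.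
  by rewrite (_ : (_ == _ :> nat) = false) ?addn0//; apply/negbTE.
by move=> k ki; rewrite !mxE (negbTE ni) eq_sym (negbTE ki) mul0r.
Qed.

End HankelOrthogonal.

(** [('X * P n)`_n] is the coefficient of degree [n - 1] of [P n], and [0] for
    [n = 0], where the determinant is constant. *)
Lemma is_derive_det_hankel (R : realType) (mu : nat -> R -> R) (t : R)
    (P : nat -> {poly R}) (g : nat -> R) (n : nat) :
  (forall k, is_derive t 1 (mu k) (mu k.+1 t)) ->
  (forall n, P n \is monic) -> (forall n, size (P n) = n.+1) ->
  (forall m n,
     \sum_(k < m.+1) \sum_(l < n.+1) (P m)`_k * (P n)`_l * mu (k + l)%N t
     = g m * (m == n)%:R) ->
  is_derive t 1 (fun s => \det (hankel (mu ^~ s) n))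
    (- ('X * P n)`_n * \det (hankel (mu ^~ t) n)).
Proof.
move=> dmu Pm Ps Po.
have := @is_derive_det R n (fun s => hankel (mu ^~ s) n)
  (\matrix_(i, j) mu (i + j).+1 t) t; rewrite /=.
have hd i j : is_derive t 1 (fun s => hankel (mu ^~ s) n i j)
   ((\matrix_(i < n, j < n) mu (i + j).+1 t) i j).
  by rewrite mxE; under eq_fun do rewrite mxE; exact: dmu.
move=> /(_ hd) /is_derive_eq; apply.
case: n hd => [|n] hd; first by rewrite big_ord0 coefXM /= oppr0 mul0r.
rewrite coefXM /= -(det_hankel_last_shift Pm Ps Po) big_ord_recr /= big1 ?add0r.
  congr (\det _); apply/matrixP => i j; rewrite !mxE -val_eqE /=.
  by case: eqP => _; rewrite ?addn1 ?addn0.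
(* The derivative of row [k] is row [k + 1], which is also present. *)
move=> k _.
have kn : (k.+1 < n.+1)%N by rewrite ltnS.
apply: (@determinant_alternate _ _ _ (widen_ord (leqnSn n) k) (Ordinal kn)).
  by rewrite -val_eqE /= ltn_eqF.
move=> j; rewrite !mxE eqxx -val_eqE /= gtn_eqF// addSn//.
Qed.

(** * Integrals on the open half line *)

Section IntegralsOnHalfLine.
Context {R : realType}.
Local Notation mu := (@lebesgue_measure R).

Lemma cvg_integral_cy_oy (f : R -> R) (a : nat -> R) :
  (forall n, 0 < a n) -> {homo a : m n / (m <= n)%N >-> n <= m} ->
  a n @[n --> \oo] --> 0 ->
  measurable_fun `](0 : R), +oo[ f -> (forall x : R, 0 < x -> 0 <= f x) ->
  (\int[mu]_(x in `[a n, +oo[) (f x)%:E @[n --> \oo] -->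
   \int[mu]_(x in `]0%R, +oo[) (f x)%:E)%E.
Proof.
move=> a0 adec acvg mf f0.
have -> : `]0, +oo[%classic = \bigcup_n `[a n, +oo[%classic.
  apply/seteqP; split => x /=.
    rewrite in_itv /= andbT => x0.
    have /cvgrPdist_lt/(_ _ x0)[N _ /(_ N (leqnn _))] := acvg.
    rewrite sub0r normrN gtr0_norm// => aNx.
    by exists N => //=; rewrite in_itv /= andbT ltW.
  case=> n _ /=; rewrite !in_itv /= !andbT; exact: lt_le_trans.
apply: ge0_nondecreasing_set_cvg_integral => //.
- move=> m n mn; rewrite subsetEset => x /=; rewrite !in_itv /= !andbT.
  by apply: le_trans; exact: adec.
- move=> n; apply/measurable_EFinP; apply: measurable_funS mf => //.
  by move=> x /=; rewrite !in_itv /= !andbT; exact: lt_le_trans.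
- move=> n x /=; rewrite in_itv /= andbT => ax; rewrite lee_fin f0//.
  exact: lt_le_trans ax.
Qed.

Lemma cvg_integral_Nyc_Nyo (f : R -> R) (a : nat -> R) :
  (forall n, 0 < a n) -> {homo a : m n / (m <= n)%N >-> n <= m} ->
  a n @[n --> \oo] --> 0 ->
  measurable_fun `]-oo, (0 : R)[ f -> (forall x : R, x < 0 -> 0 <= f x) ->
  (\int[mu]_(x in `]-oo, (- a n)%R]) (f x)%:E @[n --> \oo] -->
   \int[mu]_(x in `]-oo, 0%R[) (f x)%:E)%E.
Proof.
move=> a0 adec acvg mf f0.
have -> : `]-oo, 0[%classic = \bigcup_n `]-oo, (- a n)]%classic.
  apply/seteqP; split => x /=.
    rewrite in_itv /= -oppr_gt0 => x0.
    have /cvgrPdist_lt/(_ _ x0)[N _ /(_ N (leqnn _))] := acvg.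
    rewrite sub0r normrN gtr0_norm// => aNx.
    by exists N => //=; rewrite in_itv /= lerNr ltW.
  case=> n _ /=; rewrite !in_itv /= => xa; apply: (le_lt_trans xa).
  by rewrite oppr_lt0.
apply: ge0_nondecreasing_set_cvg_integral => //.
- move=> m n mn; rewrite subsetEset => x /=; rewrite !in_itv /= => xa.
  by apply: (le_trans xa); rewrite lerN2; exact: adec.
- move=> n; apply/measurable_EFinP; apply: measurable_funS mf => //.
  move=> x /=; rewrite !in_itv /= => xa.
  by apply: (le_lt_trans xa); rewrite oppr_lt0.
- move=> n x /=; rewrite in_itv /= => ax; rewrite lee_fin f0//.
  by apply: (le_lt_trans ax); rewrite oppr_lt0.
Qed.

Lemma nonincreasing_harmonic : {homo @harmonic R : m n / (m <= n)%N >-> n <= m}.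
Proof. by move=> m n mn; rewrite /harmonic/= lef_pV2 ?posrE// ler_nat ltnS. Qed.

Lemma continuous_within_itvcy_pos (f : R -> R) (a : R) : 0 < a ->
  {in `]0, +oo[, continuous f} -> {within `[a, +oo[, continuous f}.
Proof.
move=> a0 cf; apply: continuous_in_subspaceT => x.
by rewrite inE/= in_itv /= andbT => ax; apply: cf; rewrite in_itv /= andbT (lt_le_trans a0).
Qed.

Lemma measurable_fun_oy (f : R -> R) :
  {in `]0, +oo[, continuous f} -> measurable_fun `](0 : R), +oo[ f.
Proof.
move=> cf; apply: open_continuous_measurable_fun => // x.
by rewrite inE/= => /cf.
Qed.

(** Continuity is asked on the open half line only, so that even functions with
    an integrable singularity at the origin are covered. *)
Lemma ge0_even_integralT (f : R -> R) :
  measurable_fun setT f -> (forall x : R, 0 <= f x) ->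
  {in `]0, +oo[, continuous f} -> (forall x, f (- x) = f x) ->
  (\int[mu]_x (f x)%:E = 2%:E * \int[mu]_(x in `]0%R, +oo[) (f x)%:E)%E.
Proof.
move=> mf f0 cf fN.
have mS D : measurable_fun D (fun x => (f x)%:E).
  exact/measurable_EFinP/measurable_funTS.
have cfN : {in `]-oo, 0[, continuous f}.
  move=> x; rewrite in_itv /= => x0.
  have -> : f = f \o -%R by apply/funext => y /=; rewrite fN.
  apply: continuous_comp; first exact: continuousN.
  by apply: cf; rewrite in_itv /= andbT oppr_gt0.
have -> : (\int[mu]_x (f x)%:E = \int[mu]_(x in `]-oo, 0%R[) (f x)%:E +
    \int[mu]_(x in `]0%R, +oo[) (f x)%:E)%E.
  rewrite integral_itv_obnd_cbnd// -ge0_integral_setU//=.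
  - by rewrite -setCitvl setUv.
  - exact: mS.
  - by move=> x _; rewrite lee_fin.
  - by rewrite -setCitvl; exact/disj_setPCl.
rewrite mule_natl mule2n; congr (_ + _)%E.
have h1 := cvg_integral_cy_oy (@harmonic_gt0 R) nonincreasing_harmonic (@cvg_harmonic R)
  (measurable_funTS mf) (fun x _ => f0 x).
have h2 := cvg_integral_Nyc_Nyo (@harmonic_gt0 R) nonincreasing_harmonic (@cvg_harmonic R)
  (measurable_funTS mf) (fun x _ => f0 x).
apply: (cvg_unique _ h2) => //=.
rewrite (_ : (fun _ => _) = (fun n => \int[mu]_(x in `[harmonic n, +oo[) (f x)%:E)%E)//.
apply/funext => n; rewrite ge0_integration_by_substitutionNy.
- by apply: eq_integral => x _ /=; rewrite fN.
- apply: continuous_in_subspaceT => x.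
  rewrite inE/= in_itv /= => xa; apply: cfN; rewrite in_itv /=.
  by rewrite (le_lt_trans xa)// oppr_lt0 harmonic_gt0.
- by move=> x _; exact: f0.
Qed.

(** Change of variables for integrands and substitutions that may be singular at
    [0]: it holds on [c, +oo[ for each [c > 0], and both sides are monotone limits
    as [c] tends to [0]. *)
Lemma ge0_integral_comp_oy (F G : R -> R) (l : R) :
  {in `]0, +oo[ &, {homo F : x y / x < y}} ->
  (forall x : R, 0 < x -> derivable F x 1) ->
  {in `]0, +oo[, continuous (derive1 F)} ->
  derive1 F x @[x --> +oo%R] --> l ->
  F x @[x --> 0^'+] --> 0 -> F x @[x --> +oo%R] --> +oo%R ->
  (forall x : R, 0 < x -> 0 < F x) ->
  {in `]0, +oo[, continuous G} -> (forall x : R, 0 < x -> 0 <= G x) ->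
  (\int[mu]_(x in `]0%R, +oo[) (G x)%:E =
   \int[mu]_(x in `]0%R, +oo[) (G (F x) * derive1 F x)%:E)%E.
Proof.
move=> Fhomo dF cF' F'l F0 Fy Fpos cG G0.
have cF : {in `]0, +oo[, continuous F}.
  move=> x; rewrite in_itv/= andbT => x0.
  exact/differentiable_continuous/derivable1_diffP/dF.
have F'0 x : 0 < x -> 0 <= derive1 F x.
  move=> x0; apply: (@incr_derive1_ge0_itvy _ _ false 0).
  - by move=> y; rewrite inE/= in_itv/= andbT; exact: dF.
  - exact: Fhomo.
  - by rewrite in_itv/= andbT.
have Fle : {in `]0, +oo[ &, {homo F : x y / x <= y}}.
  move=> x y x0 y0; rewrite le_eqVlt => /predU1P[->//|xy].
  exact/ltW/Fhomo.
have hpos n : @harmonic R n \in `]0, +oo[ by rewrite in_itv/= andbT harmonic_gt0.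
have h1 := @cvg_integral_cy_oy G (F \o harmonic).
have {}h1 := h1 (fun n => Fpos _ (harmonic_gt0 n)).
have {}h1 := h1 (fun m n mn => Fle _ _ (hpos _) (hpos _) (nonincreasing_harmonic mn)).
have {}h1 : (\int[mu]_(x in `[(F \o harmonic) n, +oo[) (G x)%:E @[n --> \oo] -->
   \int[mu]_(x in `]0%R, +oo[) (G x)%:E)%E.
  apply: h1 => //; last exact: measurable_fun_oy.
  move/cvg_at_rightP : F0; apply; split; last exact: cvg_harmonic.
  by move=> n; exact: harmonic_gt0.
have h2 := @cvg_integral_cy_oy (fun x => G (F x) * derive1 F x)
  _ (@harmonic_gt0 R) nonincreasing_harmonic (@cvg_harmonic R).
have {}h2 : (\int[mu]_(x in `[harmonic n, +oo[) (G (F x) * derive1 F x)%:E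
    @[n --> \oo] --> \int[mu]_(x in `]0%R, +oo[) (G (F x) * derive1 F x)%:E)%E.
  apply: h2.
    apply: measurable_fun_oy => x x0; apply: cvgM; last exact: cF'.
    apply: (continuous_comp (cF _ x0)); apply: cG; rewrite in_itv/= andbT.
    by apply: Fpos; move: x0; rewrite in_itv/= andbT.
  by move=> x x0; rewrite mulr_ge0 ?F'0 ?G0 ?Fpos.
apply: (cvg_unique _ h1) => //=.
rewrite (_ : (fun _ => _) =
  (fun n => \int[mu]_(x in `[harmonic n, +oo[) (G (F x) * derive1 F x)%:E)%E)//.
apply/funext => n.
rewrite -[n.+1%:R^-1]/(@harmonic R n).
move: (@harmonic R n) (@harmonic_gt0 R n) => c c0.
have sub x : x \in `[c, +oo[ -> x \in `]0, +oo[.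
  by rewrite !in_itv/= !andbT; exact: lt_le_trans.
have sub' x : x \in `]c, +oo[ -> x \in `]0, +oo[.
  by rewrite !in_itv/= !andbT; exact: lt_trans.
have c0y : c \in `]0, +oo[ by rewrite in_itv/= andbT.
apply: increasing_ge0_integration_by_substitutiony.
- by move=> x y /sub x0 /sub y0; exact: Fhomo.
- by move=> x /sub'; exact: cF'.
- by apply/cvg_ex; exists (derive1 F c); apply: cvg_at_right_filter; exact: cF'.
- by apply/cvg_ex; exists l.
- split; last by apply: cvg_at_right_filter; exact: cF.
  by move=> x /sub'; rewrite in_itv/= andbT; exact: dF.
- exact: Fy.
- by apply: continuous_within_itvcy_pos => //; exact: Fpos.
- move=> x; rewrite in_itv/= andbT => xn; apply: G0.
  by apply: lt_trans xn; exact: Fpos.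
Qed.

End IntegralsOnHalfLine.

(** * Convergence of the Gamma integral *)

Section GammaIntegrability.
Context {R : realType}.
Local Notation mu := (@lebesgue_measure R).

Lemma continuous_powR_pos (b x : R) : 0 < x -> {for x, continuous (fun y : R => y `^ b)}.
Proof.
move=> x0; apply/differentiable_continuous/derivable1_diffP.
by apply: derivable_powR; rewrite in_itv/= andbT.
Qed.

Lemma cvgry_powR (b : R) : 0 < b -> (x : R) `^ b @[x --> +oo%R] --> +oo%R.
Proof.
move=> b0; apply/cvgryPge => A; near=> x.
have x0 : 0 <= x by near: x; exact: nbhs_pinfty_ge.
have xA : `|A| `^ b^-1 <= x by near: x; exact: nbhs_pinfty_ge.
rewrite (le_trans (ler_norm A))//.
rewrite -[leLHS]powRr1// -(mulVf (lt0r_neq0 b0)) powRrM.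
by rewrite ge0_ler_powR ?nnegrE ?powR_ge0// ltW.
Unshelve. all: by end_near. Qed.

(** The derivative of the bounded function [- (1 + x `^ b)^-1], hence integrable
    on the half line, and comparable to [x `^ (b - 1)] near [0]. *)
Definition powR_dominator (b x : R) := b * x `^ (b - 1) / (1 + x `^ b) ^+ 2.

Let powR_dominator_ge0 (b x : R) : 0 < b -> 0 <= powR_dominator b x.
Proof.
move=> b0; apply: divr_ge0; last exact: sqr_ge0.
by apply: mulr_ge0; [exact: ltW|exact: powR_ge0].
Qed.

Let den_gt0 (b x : R) : 0 < 1 + x `^ b.
Proof. by rewrite ltr_wpDr ?powR_ge0. Qed.

Let continuous_powR_dominator (b : R) : 0 < b ->
  {in `]0, +oo[, continuous (powR_dominator b)}.
Proof.
move=> b0 x; rewrite in_itv/= andbT => x0.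
have c1 : {for x, continuous (fun x => b * x `^ (b - 1))}.
  by apply: cvgM; [exact: cvg_cst|exact: continuous_powR_pos].
have c2 : {for x, continuous (fun x => 1 + x `^ b)}.
  by apply: cvgD; [exact: cvg_cst|exact: continuous_powR_pos].
apply: cvgM; first exact: c1.
apply: cvgV; first by rewrite expf_neq0// gt_eqF.
rewrite expr2; under eq_fun do rewrite expr2.
by apply: cvgM; exact: c2.
Qed.

Lemma integral_powR_dominator_le1 (b : R) : 0 < b ->
  (\int[mu]_(x in `]0%R, +oo[) (powR_dominator b x)%:E <= 1)%E.
Proof.
move=> b0.
have h := cvg_integral_cy_oy (@harmonic_gt0 R) (@nonincreasing_harmonic R)
  (@cvg_harmonic R) (measurable_fun_oy (continuous_powR_dominator b0))
  (fun x _ => powR_dominator_ge0 x b0).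
apply: (cvge_le _ h); apply: nearW => n.
move: (@harmonic R n) (@harmonic_gt0 R n) => c c0.
pose F (x : R) := - (1 + x `^ b)^-1.
have dF (x : R) : 0 < x -> is_derive x 1 F (powR_dominator b x).
  move=> x0.
  have d1 : is_derive x 1 (fun x : R => 1 + x `^ b) (b * x `^ (b - 1)).
    apply: is_derive_eq.
      by apply: is_deriveD; exact: is_derive1_powR.
    by rewrite add0r.
  apply: is_derive_eq.
    by apply: is_deriveN; apply: is_deriveV; rewrite gt_eqF.
  by rewrite scaleNr opprK -[LHS]/(_ * _) mulrC.
rewrite (@ge0_continuous_FTC2y _ (powR_dominator b) F c 0).
- by rewrite /F -EFinB lee_fin sub0r opprK invf_le1// lerDl powR_ge0.
- by move=> x _; exact: powR_dominator_ge0.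
- by apply: continuous_within_itvcy_pos => //; exact: continuous_powR_dominator.
- rewrite -oppr0; apply: cvgN; apply/gtr0_cvgV0.
    by near=> x; exact: den_gt0.
  apply/cvgryPge => A.
  have /cvgryPge/(_ A) := cvgry_powR b0.
  by apply: filterS => x /le_trans; apply; rewrite lerDr.
- by move=> x cx; have [] := dF x (lt_trans c0 cx).
- apply: cvg_at_right_filter; apply/differentiable_continuous/derivable1_diffP.
  by have [] := dF _ c0.
- move=> x; rewrite in_itv/= andbT => cx.
  by rewrite derive1E; have [_ ->] := dF x (lt_trans c0 cx).
Unshelve. all: by end_near. Qed.

(** From [ln y < y] at [y = x / (2 * b)]. *)
Lemma powR_le_expR (b x : R) : 0 < b -> 0 < x ->
  x `^ b <= (2 * b) `^ b * expR (x / 2).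
Proof.
move=> b0 x0; have bb : 0 < 2 * b by rewrite mulr_gt0.
rewrite /powR !gt_eqF// -expRD ler_expR.
have := ln_sublinear (divr_gt0 x0 bb).
rewrite ln_div ?posrE// => /ltW.
rewrite -(ler_pM2l b0) mulrBr lerBlDl => /le_trans; apply.
rewrite lerD2l (_ : b * (x / (2 * b)) = x / 2)//.
by field; rewrite gt_eqF.
Qed.

(** With [b = a + 1], the integrand is at most a constant times
    [powR_dominator b], because [(1 + x `^ b) ^+ 2] grows at most like [expR x]. *)
Lemma integrable_powR_expRN (a : R) : -1 < a ->
  mu.-integrable `](0 : R), +oo[ (fun x => (x `^ a * expR (- x))%:E).
Proof.
move=> a1; pose b := a + 1; have b0 : 0 < b by rewrite /b -ltrBlDr sub0r.
have cg : {in `]0, +oo[, continuous (fun x => x `^ a * expR (- x))}.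
  move=> x; rewrite in_itv/= andbT => x0.
  apply: cvgM; first exact: continuous_powR_pos.
  by apply: continuous_comp; [exact: continuousN|exact: continuous_expR].
have mg := measurable_fun_oy cg.
pose K := (2 * b) `^ b; pose C := (1 + K) ^+ 2 / b.
apply: (@le_integrable _ _ _ mu _ _ _ (fun x => (C * powR_dominator b x)%:E)) => //.
- exact/measurable_EFinP.
- move=> x /=; rewrite in_itv/= andbT => x0.
  have C0 : 0 <= C by apply: divr_ge0; [exact: sqr_ge0|exact: ltW].
  rewrite lee_fin (ger0_norm (mulr_ge0 (powR_ge0 _ _) (expR_ge0 _))).
  rewrite (ger0_norm (mulr_ge0 C0 (powR_dominator_ge0 x b0))).
  have ba : b - 1 = a by rewrite addrK.
  have E k y z : y != 0 -> k / b * (b * z / y) = z * (k / y).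
    by move=> y0; field; rewrite y0 gt_eqF.
  rewrite /C /powR_dominator ba E; last by rewrite expf_neq0// gt_eqF// den_gt0.
  rewrite ler_wpM2l ?powR_ge0// ler_pdivlMr ?exprn_gt0//.
  rewrite expRN ler_pdivrMl ?expR_gt0//.
  have -> : expR x * (1 + K) ^+ 2 = (expR (x / 2) * (1 + K)) ^+ 2.
    by rewrite exprMn -expRM_natl -mulr_natl; congr (expR _ * _); field.
  have K0 : 0 <= K by exact: powR_ge0.
  have key : 1 + x `^ b <= expR (x / 2) * (1 + K).
    rewrite mulrDr mulr1 lerD//; last by rewrite mulrC powR_le_expR.
    by rewrite -expR0 ler_expR divr_ge0// ltW.
  apply: lerXn2r key; rewrite nnegrE.
    by rewrite ltW// den_gt0.
  by rewrite mulr_ge0 ?expR_ge0// addr_ge0.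
- have -> : (fun x => (C * powR_dominator b x)%:E) =
      (fun x => (C%:E * (powR_dominator b x)%:E)%E).
    by apply/funext => x; rewrite EFinM.
  apply: integrableZl => //; apply/integrableP; split.
    by apply/measurable_EFinP; exact: (measurable_fun_oy (continuous_powR_dominator b0)).
  under eq_integral do rewrite gee0_abs ?lee_fin ?powR_dominator_ge0//.
  by apply: (le_lt_trans (integral_powR_dominator_le1 b0)); rewrite ltey.
Qed.

End GammaIntegrability.

(** * Moments of the generalized Freud weight *)

Section FreudMoments.
Context {R : realType}.
Local Notation mu := (@lebesgue_measure R).
Implicit Types lam t x : R.

Lemma freud_weight_ge0 lam t x : 0 <= freud_weight lam t x.
Proof. by rewrite mulr_ge0 ?powR_ge0 ?expR_ge0. Qed.

Lemma freud_weightN lam t x : freud_weight lam t (- x) = freud_weight lam t x.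
Proof.
have x4 : (- x) ^+ 4 = x ^+ 4 by ring.
by rewrite /freud_weight normrN sqrrN x4.
Qed.

Lemma measurable_freud_weight lam t :
  measurable_fun [set: R] (freud_weight lam t).
Proof.
apply: measurable_funM.
  by apply: (measurableT_comp (measurable_powR (2 * lam + 1))); exact: normr_measurable.
apply: (measurableT_comp (@measurable_expR R)); apply: measurable_funD.
  by apply: measurableT_comp => //; exact: measurable_funX.
by apply: measurable_funM => //; exact: measurable_funX.
Qed.

Lemma continuous_freud_weight lam t :
  {in `]0, +oo[, continuous (freud_weight lam t)}.
Proof.
move=> x; rewrite in_itv/= andbT => x0; apply: cvgM.
  apply: (@continuous_comp R R R (fun y => `|y|) (fun y => y `^ (2 * lam + 1))).
    exact: norm_continuous.
  by apply: continuous_powR_pos; rewrite normr_gt0 gt_eqF.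
apply: (@continuous_comp R R R (fun y => - y ^+ 4 + t * y ^+ 2) expR).
  apply: cvgD; first by apply: cvgN; exact: exprn_continuous.
  by apply: cvgM; [exact: cvg_cst|exact: exprn_continuous].
exact: continuous_expR.
Qed.

Lemma integral_freud_weight lam t :
  (\int[mu]_x (freud_weight lam t x)%:E =
   2%:E * \int[mu]_(x in `]0%R, +oo[) (freud_weight lam t x)%:E)%E.
Proof.
apply: ge0_even_integralT.
- exact: measurable_freud_weight.
- exact: freud_weight_ge0.
- exact: continuous_freud_weight.
- exact: freud_weightN.
Qed.

(** On the half line, [- x ^ 4 + t x ^ 2 + x] is bounded above, so the weight is
    dominated by the Gamma integrand [x `^ (2 * lam + 1) * expR (- x)]. *)
Lemma integrable_freud_weight lam t : -1 < lam ->
  mu.-integrable [set: R] (EFin \o freud_weight lam t).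
Proof.
move=> lam1; apply/integrableP; split.
  by apply/measurable_EFinP; exact: measurable_freud_weight.
under eq_integral do rewrite gee0_abs ?lee_fin ?freud_weight_ge0//.
rewrite integral_freud_weight.
have a1 : -1 < 2 * lam + 1 by lra.
(* The bound comes from completing squares in [x ^ 4 - t x ^ 2 - x], in [x ^ 2]
   and then in [x]. *)
pose K := expR ((t + 1) ^+ 2 / 4 + 4^-1).
have iK : mu.-integrable `](0 : R), +oo[
    (fun x => K%:E * (x `^ (2 * lam + 1) * expR (- x))%:E)%E.
  by apply: integrableZl => //; exact: integrable_powR_expRN.
have : mu.-integrable `](0 : R), +oo[ (EFin \o freud_weight lam t).
  apply: le_integrable iK => //.
    by apply/measurable_EFinP/measurable_funTS; exact: measurable_freud_weight.
  move=> x /=; rewrite in_itv/= andbT => x0.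
  rewrite lee_fin ger0_norm ?freud_weight_ge0//.
  rewrite ger0_norm ?mulr_ge0 ?powR_ge0 ?expR_ge0//.
  rewrite /freud_weight gtr0_norm// [leRHS]mulrCA ler_wpM2l ?powR_ge0//.
  rewrite -expRD ler_expR.
  rewrite -subr_ge0.
  have -> : (t + 1) ^+ 2 / 4 + 4^-1 + - x - (- x ^+ 4 + t * x ^+ 2) =
      (x ^+ 2 - (t + 1) / 2) ^+ 2 + (x - 2^-1) ^+ 2 by field.
  by rewrite addr_ge0 ?sqr_ge0.
move/integrableP => [_].
under eq_integral do rewrite gee0_abs ?lee_fin ?freud_weight_ge0//.
move=> h; rewrite lte_mul_pinfty// ?lee_fin//.
Qed.

(** This holds at [x = 0] too: for [0 < k] the exponent [2 * (lam + k) + 1] is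
    positive, so both sides vanish. *)
Lemma exprM_freud_weight (k : nat) lam t x : -1 < lam ->
  x ^+ 2 ^+ k * freud_weight lam t x = freud_weight (lam + k%:R) t x.
Proof.
move=> lam1; rewrite /freud_weight mulrA; congr (_ * _).
case: k => [|k]; first by rewrite expr0 mul1r addr0.
have [->|x0] := eqVneq x 0.
  rewrite normr0 expr0n/= expr0n/= mul0r powR0//.
  rewrite gt_eqF// -natr1; have : 0 <= k%:R :> R by []. lra.
have -> : 2 * (lam + k.+1%:R) + 1 = 2 * k.+1%:R + (2 * lam + 1) by ring.
rewrite [RHS]powRD; last by rewrite normr_eq0 x0 implybT.
congr (_ * _); rewrite powRrM powR_mulrn ?powR_ge0//.
by rewrite powR_mulrn// real_normK ?num_real.
Qed.

Lemma is_derive_freud_weight lam t x : -1 < lam ->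
  is_derive t 1 (fun s => freud_weight lam s x) (freud_weight (lam + 1) t x).
Proof.
move=> lam1; have := exprM_freud_weight 1 t x lam1; rewrite expr1 => <-.
rewrite /freud_weight.
apply: is_derive_eq.
by rewrite /GRing.scale /=; ring.
Qed.

(** For [s < t + 1] the [s]-derivative of the weight is at most its value at
    [t + 1], which dominates the difference quotients near [t]. *)
Lemma is_derive_freud_phi lam t : -1 < lam ->
  is_derive t 1 (freud_phi lam) (freud_phi (lam + 1) t).
Proof.
move=> lam1.
have lam2 : -1 < lam + 1 by lra.
have d (s x : R) := is_derive_freud_weight s x lam1.
pose f (s x : R) := freud_weight lam s x.
have dE s x : partial1of2 f s x = freud_weight (lam + 1) s x.
  by rewrite partial1of2E; have [_ ->] := d s x.
have It : `](t - 1), (t + 1)[%classic t by rewrite /= in_itv/=; apply/andP; split; lra.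
have intf s : `](t - 1), (t + 1)[%classic s ->
    mu.-integrable [set: R] (EFin \o f s).
  by move=> _; exact: integrable_freud_weight.
have df s x : `](t - 1), (t + 1)[%classic s -> [set: R] x -> derivable (f ^~ x) s 1.
  by move=> _ _; have [] := d s x.
have ub s x : `](t - 1), (t + 1)[%classic s -> [set: R] x ->
    `|partial1of2 f s x| <= freud_weight (lam + 1) (t + 1) x.
  rewrite /= in_itv/= => /andP[_ st] _.
  rewrite dE ger0_norm ?freud_weight_ge0// /freud_weight ler_wpM2l ?powR_ge0//.
  by rewrite ler_expR lerD2l ler_wpM2r ?sqr_ge0// ltW.
have iG := integrable_freud_weight (t + 1) lam2.
have G0 := freud_weight_ge0 (lam + 1) (t + 1).
constructor.
  exact: (derivable_under_integral (@measurableT _ _) It intf df G0 iG ub).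
rewrite -derive1E.
have -> := differentiation_under_integral (@measurableT _ _) It intf df G0 iG ub.
by apply: eq_Rintegral => x _; exact: dE.
Qed.

Lemma derive1n_freud_phi (k : nat) lam : -1 < lam ->
  derive1n k (freud_phi lam) = freud_phi (lam + k%:R).
Proof.
move=> lam1; elim: k => [|k IH]; first by rewrite derive1n0 addr0.
apply/funext => t; rewrite derive1nS IH derive1E.
have lamk : -1 < lam + k%:R by rewrite ltr_wpDr.
by have [_ ->] := is_derive_freud_phi t lamk; rewrite -addrA natr1.
Qed.

Lemma derive1n_derive1n (j k : nat) (f : R -> R) :
  derive1n j (derive1n k f) = derive1n (j + k) f.
Proof. by rewrite /derive1n iterD. Qed.

Lemma freud_tauE (n : nat) lam t : -1 < lam ->
  freud_tau n lam t = \det (hankel (fun k => freud_phi (lam + k%:R) t) n).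
Proof.
move=> lam1; congr (\det _); apply/matrixP => i j; rewrite !mxE.
by rewrite derive1n_derive1n derive1n_freud_phi.
Qed.

(** The bilinear form of the weight on polynomials in [x ^ 2] has Gram matrix the
    Hankel matrix of the shifted [freud_phi]. *)
Lemma integral_horner_sqr_freud (p q : {poly R}) lam t : -1 < lam ->
  \int[mu]_x (p.[x ^+ 2] * q.[x ^+ 2] * freud_weight lam t x) =
  \sum_(i < size p) \sum_(j < size q)
    p`_i * q`_j * freud_phi (lam + (i + j)%:R) t.
Proof.
move=> lam1.
have lamk k : -1 < lam + k%:R by rewrite ltr_wpDr.
pose h (c : R) k (x : R) := c * freud_weight (lam + k%:R) t x.
have ih c k : mu.-integrable [set: R] (EFin \o h c k).
  apply: eq_integrable (integrableZl _ c (integrable_freud_weight t (lamk k))) => //.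
have Eh c k : \int[mu]_x h c k x = c * freud_phi (lam + k%:R) t.
  by rewrite RintegralZl//; exact: integrable_freud_weight.
rewrite (_ : (fun x => _) = fun x =>
    \sum_(i < size p) \sum_(j < size q) h (p`_i * q`_j) (i + j)%N x); last first.
  apply/funext => x; rewrite !horner_coef big_distrlr/= mulr_suml.
  apply: eq_bigr => i _; rewrite mulr_suml; apply: eq_bigr => j _.
  by rewrite /h -exprM_freud_weight// exprD; ring.
have Rsum (I : Type) (r : seq I) (F : I -> R -> R) :
    (forall i, mu.-integrable [set: R] (EFin \o F i)) ->
    mu.-integrable [set: R] (EFin \o (fun x => \sum_(i <- r) F i x)) /\
    \int[mu]_x (\sum_(i <- r) F i x) = \sum_(i <- r) \int[mu]_x F i x.
  move=> iF; elim: r => [|i r [IH1 IH2]].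
    under eq_fun do rewrite big_nil; rewrite big_nil Rintegral_cst// mul0r; split => //.
    exact: integrable0.
  under eq_fun do rewrite big_cons; rewrite big_cons RintegralD// IH2; split => //.
  exact: (integrableD _ (iF i) IH1).
have i2 i := (Rsum _ (index_enum 'I_(size q))
  (fun j : 'I_(size q) => h (p`_i * q`_j) (i + j)%N) (fun j => ih _ _)).
rewrite (Rsum _ _ _ (fun i : 'I_(size p) => (i2 i).1)).2.
apply: eq_bigr => i _; rewrite (i2 i).2; apply: eq_bigr => j _.
exact: Eh.
Qed.

End FreudMoments.

(** * The parabolic cylinder function *)

Section ParabolicCylinder.
Context {R : realType}.
Local Notation mu := (@lebesgue_measure R).

(** The integral is finite, and bounded below by that of a positive constant over
    [1, 2]. *)
Lemma euler_gamma_gt0 (z : R) : 0 < z -> 0 < euler_gamma z.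
Proof.
move=> z0; have a1 : -1 < z - 1 by rewrite ltrBrDr addrC subrr.
have ig := integrable_powR_expRN a1.
pose c := expR (- (`|z - 1| * 2) + - 2).
have cf (s : R) : 1 <= s -> s <= 2 -> c <= s `^ (z - 1) * expR (- s).
  move=> s1 s2; have s0 : 0 < s by rewrite (lt_le_trans _ s1).
  rewrite /powR gt_eqF// -expRD ler_expR lerD ?lerN2//.
  apply: (@le_trans _ _ (- `|(z - 1) * ln s|)); last by rewrite lerNl -normrN ler_norm.
  rewrite lerN2 normrM ler_wpM2l// ger0_norm ?ln_ge0//.
  by rewrite (le_trans (ltW (ln_sublinear s0))).
have sub : `[(1 : R), 2] `<=` `](0 : R), +oo[.
  by move=> s /=; rewrite !in_itv/= andbT => /andP[s1 _]; rewrite (lt_le_trans _ s1).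
have f0 (s : R) : (0 <= (s `^ (z - 1) * expR (- s))%:E)%E.
  by rewrite lee_fin mulr_ge0 ?powR_ge0 ?expR_ge0.
have mf D : measurable_fun D (fun s : R => (s `^ (z - 1) * expR (- s))%:E).
  apply/measurable_EFinP/measurable_funTS/measurable_funM.
    exact: measurable_powR.
  exact: (measurableT_comp (@measurable_expR R)).
have h : (c%:E <= \int[mu]_(s in `]0%R, +oo[) (s `^ (z - 1) * expR (- s))%:E)%E.
  apply: (@le_trans _ _
    (\int[mu]_(s in `[1%R, 2%R]) (s `^ (z - 1) * expR (- s))%:E)%E); last first.
    by apply: ge0_subset_integral => //; exact: mf.
  have -> : c%:E = (\int[mu]_(s in `[1%R, 2%R]) c%:E)%E.
    rewrite integral_cst//= lebesgue_measure_itv/= lte_fin ltr1n -EFinB.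
    by rewrite -EFinM; congr EFin; ring.
  apply: ge0_le_integral => //.
  - by move=> s _; rewrite lee_fin expR_ge0.
  - exact: mf.
  - by move=> s /=; rewrite in_itv/= lee_fin => /andP[]; exact: cf.
rewrite /euler_gamma /Rintegral fine_gt0//; apply/andP; split.
  by apply: lt_le_trans h; rewrite lte_fin expR_gt0.
by rewrite ltey_eq (integrable_fin_num _ ig).
Qed.

(** True at infinity as well, since [fine] sends both infinities to [0]. *)
Lemma fine_mulr_gt0 (r : R) (y : \bar R) : 0 < r -> fine (r%:E * y) = r * fine y.
Proof.
move=> r0; case: y => [s| |] //=.
- by rewrite gt0_muley ?lte_fin// mulr0.
- by rewrite gt0_muleNy ?lte_fin// mulr0.
Qed.

(** The weight is even, and [x = F s] with [F s = 2 `^ (- 1 / 4) * s `^ (1 / 2)]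
    inverts [s = sqrt 2 * x ^ 2], so that [x ^ 4 = s ^ 2 / 2] and
    [t x ^ 2 = (sqrt 2 * t / 2) s]. *)
Lemma freud_phi_parabolic_cylinder (lam t : R) : -1 < lam ->
  freud_phi lam t =
    euler_gamma (lam + 1) / 2 `^ ((lam + 1) / 2) * expR (t ^+ 2 / 8) *
    parabolic_cylinder (- lam - 1) (- (Num.sqrt 2 * t / 2)).
Proof.
move=> lam1; pose k : R := 2 `^ (- 4^-1).
have k0 : 0 < k by exact: powR_gt0.
pose F (s : R) := k * s `^ 2^-1.
have dF (s : R) : 0 < s -> is_derive s 1 F (k * (2^-1 * s `^ (2^-1 - 1))).
  by move=> s0; apply: is_deriveZ; exact: is_derive1_powR.
have F'E (s : R) : 0 < s -> derive1 F s = k * (2^-1 * s `^ (2^-1 - 1)).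
  by move=> s0; rewrite derive1E; have [_ ->] := dF s s0.
have Fpos (s : R) : 0 < s -> 0 < F s by move=> s0; rewrite mulr_gt0 ?powR_gt0.
have k2 : k ^+ 2 = (Num.sqrt 2)^-1.
  rewrite -powR_mulrn ?ltW// -powRrM -powR12_sqrt// -powRN; congr (_ `^ _).
  by field.
have F2 (s : R) : 0 < s -> F s ^+ 2 = s / Num.sqrt 2.
  move=> s0; rewrite exprMn k2 mulrC; congr (_ * _).
  by rewrite -powR_mulrn ?powR_ge0// -powRrM mulVf// powRr1// ltW.
have s22 : Num.sqrt 2 ^+ 2 = 2 :> R by rewrite sqr_sqrtr.
have s20 : Num.sqrt 2 != 0 :> R by rewrite gt_eqF// sqrtr_gt0.
have rV : (Num.sqrt 2)^-1 = Num.sqrt 2 / 2 :> R.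
  by apply: (mulfI s20); rewrite divff// mulrA -expr2 s22 divff.
pose xi := - (Num.sqrt 2 * t / 2).
pose c : R := (2 `^ ((lam + 1) / 2))^-1 / 2.
have c0 : 0 < c by rewrite divr_gt0// invr_gt0 powR_gt0.
have key (s : R) : 0 < s -> freud_weight lam t (F s) * derive1 F s =
    c * (s `^ lam * expR (- (s ^+ 2 / 2) - xi * s)).
  move=> s0; rewrite /freud_weight gtr0_norm ?Fpos// F'E//.
  have -> : F s ^+ 4 = s ^+ 2 / 2.
    by rewrite (exprM _ 2 2) F2// expr_div_n s22.
  have -> : - (s ^+ 2 / 2) + t * F s ^+ 2 = - (s ^+ 2 / 2) - xi * s.
    by rewrite F2// /xi rV; ring.
  have hk : k `^ (2 * lam + 1) * k = (2 `^ ((lam + 1) / 2))^-1.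
    rewrite -[X in _ * X](powRr1 (ltW k0)) -powRD ?(lt0r_neq0 k0) ?implybT//.
    by rewrite -powRrM -powRN; congr (_ `^ _); field.
  have hs : (s `^ 2^-1) `^ (2 * lam + 1) * s `^ (2^-1 - 1) = s `^ lam.
    rewrite -powRrM -powRD ?(lt0r_neq0 s0) ?implybT//.
    by congr (_ `^ _); field.
  rewrite /F powRM ?powR_ge0 ?(ltW k0)// /c -hk -hs.
  move: (_ `^ _) (expR _) (_ `^ _) (_ `^ _) => p e q r; ring.
rewrite /freud_phi /Rintegral integral_freud_weight (fine_mulr_gt0 _ (ltr0Sn _ 1)).
rewrite (@ge0_integral_comp_oy _ F _ 0).
- have -> : (\int[mu]_(s in `]0%R, +oo[) (freud_weight lam t (F s) * derive1 F s)%:E =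
      c%:E * \int[mu]_(s in `]0%R, +oo[)
        (s `^ lam * expR (- (s ^+ 2 / 2) - xi * s))%:E)%E.
    rewrite -ge0_integralZl_EFin//=.
    + apply: eq_integral => s; rewrite inE/= in_itv/= andbT => s0.
      by rewrite -EFinM key.
    + by move=> s _; rewrite lee_fin mulr_ge0 ?powR_ge0 ?expR_ge0.
    + apply/measurable_EFinP/measurable_funTS/measurable_funM.
        exact: measurable_powR.
      apply: (measurableT_comp (@measurable_expR R)); apply: measurable_funB.
        by apply: measurableT_comp => //; exact: measurable_funM.
      exact: measurable_funM.
    + exact: ltW.
  rewrite (fine_mulr_gt0 _ c0) /parabolic_cylinder /Rintegral.
  have -> : - (- lam - 1) = lam + 1 by ring.
  rewrite addrK -/xi.
  set I := fine _.
  have g0 : euler_gamma (lam + 1) != 0.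
    by rewrite gt_eqF// euler_gamma_gt0// -ltrBlDr sub0r.
  have -> : - xi ^+ 2 / 4 = - (t ^+ 2 / 8).
    by rewrite /xi sqrrN expr_div_n exprMn s22; field.
  rewrite expRN /c; field.
  by rewrite g0 gt_eqF ?expR_gt0// gt_eqF ?powR_gt0.
- move=> x y; rewrite !in_itv/= !andbT => x0 y0 xy.
  by rewrite ltr_pM2l// gt0_ltr_powR ?nnegrE ?ltW// invr_gt0.
- by move=> x x0; have [] := dF x x0.
- move=> x; rewrite in_itv/= andbT => x0.
  have ck : {for x, continuous (fun y : R => k * (2^-1 * y `^ (2^-1 - 1)))}.
    apply: cvgM; first exact: cvg_cst.
    by apply: cvgM; [exact: cvg_cst|exact: continuous_powR_pos].
  rewrite /continuous_at F'E//; apply: cvg_trans ck.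
  by apply: near_eq_cvg; near=> y; rewrite F'E//; near: y; exact: lt_nbhsr.
- have cV : (x `^ 2^-1)^-1 @[x --> +oo%R] --> (0 : R).
    apply/gtr0_cvgV0; last by apply: cvgry_powR; rewrite invr_gt0.
    by near=> y; apply: powR_gt0; near: y; exact: nbhs_pinfty_gt.
  have ck : k * (2^-1 * (x `^ 2^-1)^-1) @[x --> +oo%R] --> (k * (2^-1 * 0)).
    by apply: cvgM; [exact: cvg_cst|apply: cvgM; [exact: cvg_cst|exact: cV]].
  rewrite !mulr0 in ck; apply: cvg_trans ck.
  apply: near_eq_cvg; near=> y.
  have y0 : 0 < y by near: y; exact: nbhs_pinfty_gt.
  by rewrite F'E// -powRN; congr (_ * (_ * _ `^ _)); lra.
- have cF : F x @[x --> 0^'+] --> k * 0.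
    by apply: cvgM; [exact: cvg_cst|apply: powR_cvg0; rewrite invr_gt0].
  by rewrite mulr0 in cF.
- apply/cvgryPge => A.
  have h2 : 0 < 2^-1 :> R by rewrite invr_gt0.
  have /cvgryPge/(_ (A / k)) := cvgry_powR h2.
  by apply: filterS => x; rewrite ler_pdivrMr// mulrC.
- exact: Fpos.
- exact: continuous_freud_weight.
- by move=> x _; exact: freud_weight_ge0.
Unshelve. all: by end_near. Qed.

End ParabolicCylinder.

(** * Symmetric three-term recurrences *)

Section SymmetricThreeTerm.
Variables (R : realType) (S : nat -> {poly R}) (beta : nat -> R).
Hypothesis S_monic : forall n, S n \is monic.
Hypothesis size_S : forall n, size (S n) = n.+1.
Hypothesis S_rec : forall n, 'X * S n = S n.+1 + beta n *: poly_pred S n.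

Let even_part n := even_poly (S n.*2).
Let odd_part n := odd_poly (S n.*2.+1).

Let S_lead n : (S n)`_n = 1.
Proof. by have /monicP := S_monic n; rewrite /lead_coef size_S. Qed.

Let coefS n k : (S n.+1)`_k = ('X * S n)`_k - beta n * (poly_pred S n)`_k.
Proof. by rewrite S_rec coefD coefZ addrK. Qed.

Lemma three_term_parity n k : odd (n + k) -> (S n)`_k = 0.
Proof.
elim/ltn_ind: n k => -[|n] IH k nk.
  by rewrite nth_default// size_S; case: k nk.
rewrite coefS coefXM; have -> : (poly_pred S n)`_k = 0.
  by case: n IH nk => [|n] IH nk; rewrite /= ?coef0// IH//; move: nk; rewrite /= negbK.
rewrite mulr0 subr0; case: k nk => [|k] //= nk; apply: IH => //.
by move: nk; rewrite addnS /= negbK.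
Qed.

Lemma horner_even_part n x : (S n.*2).[x] = (even_part n).[x ^+ 2].
Proof.
rewrite -{1}(poly_even_odd (S n.*2)) (_ : odd_poly _ = 0).
  by rewrite comp_poly0 mul0r addr0 horner_comp hornerXn.
apply/polyP => k; rewrite coef_odd_poly coef0 three_term_parity//.
by rewrite addnS /= oddD !odd_double.
Qed.

Lemma horner_odd_part n x : (S n.*2.+1).[x] = (odd_part n).[x ^+ 2] * x.
Proof.
rewrite -{1}(poly_even_odd (S n.*2.+1)) (_ : even_poly _ = 0).
  by rewrite comp_poly0 add0r hornerMX horner_comp hornerXn.
apply/polyP => k; rewrite coef_even_poly coef0 three_term_parity//.
by rewrite addSn /= oddD !odd_double.
Qed.

Lemma size_even_part n : size (even_part n) = n.+1.
Proof.
by rewrite size_even_poly_eq size_S /= ?odd_double// doubleK.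
Qed.

Lemma size_odd_part n : size (odd_part n) = n.+1.
Proof. by rewrite size_odd_poly_eq size_S /= ?odd_double// doubleK. Qed.

Lemma even_part_monic n : even_part n \is monic.
Proof. by rewrite monicE /lead_coef size_even_part coef_even_poly S_lead. Qed.

Lemma odd_part_monic n : odd_part n \is monic.
Proof. by rewrite monicE /lead_coef size_odd_part coef_odd_poly S_lead. Qed.

(** Subleading coefficients in [Q_n = P_n - beta_(2n) Q_(n-1)]. *)
Lemma beta_even n : beta 0%N = 0 ->
  beta n.*2 = ('X * even_part n)`_n - ('X * odd_part n)`_n.
Proof.
move=> b0; rewrite !coefXM; case: n => [|n] /=; first by rewrite b0 subrr.
rewrite coef_even_poly coef_odd_poly [in X in _ - X]coefS coefXM /= S_lead mulr1.
by rewrite opprB addrC subrK.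
Qed.

(** Subleading coefficients in [P_(n+1) = y Q_n - beta_(2n+1) P_n]. *)
Lemma beta_odd n :
  beta n.*2.+1 = ('X * odd_part n)`_n - ('X * even_part n.+1)`_n.+1.
Proof.
rewrite !coefXM /= coef_even_poly coef_odd_poly doubleS.
rewrite [in X in _ - X]coefS coefXM /= S_lead mulr1 opprB addrC.
by case: n => [|n] /=; rewrite subrK.
Qed.

End SymmetricThreeTerm.

(** * Logarithmic derivatives of the determinants *)

Section FreudTau.
Variables (R : realType) (lam t : R) (P : nat -> {poly R}) (g : nat -> R).
Hypothesis lam_gt : -1 < lam.
Hypothesis P_monic : forall n, P n \is monic.
Hypothesis size_P : forall n, size (P n) = n.+1.
Hypothesis g_gt0 : forall n, 0 < g n.
Hypothesis P_orth : forall m n,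
  \int[@lebesgue_measure R]_x
    ((P m).[x ^+ 2] * (P n).[x ^+ 2] * freud_weight lam t x)
  = g m * (m == n)%:R.

Let moments_orth m n :
  \sum_(k < m.+1) \sum_(l < n.+1)
    (P m)`_k * (P n)`_l * freud_phi (lam + (k + l)%:R) t
  = g m * (m == n)%:R.
Proof. by rewrite -P_orth integral_horner_sqr_freud// !size_P. Qed.

Lemma freud_tau_gt0 n : 0 < freud_tau n lam t.
Proof.
rewrite freud_tauE// (det_hankel_orthogonal P_monic size_P moments_orth).
by apply: prodr_gt0.
Qed.

Lemma is_derive_freud_tau n :
  is_derive t 1 (freud_tau n lam) (- ('X * P n)`_n * freud_tau n lam t).
Proof.
rewrite freud_tauE//.
rewrite (_ : freud_tau n lam =
  (fun s => \det (hankel (fun k => freud_phi (lam + k%:R) s) n))); last first.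
  by apply/funext => s; rewrite freud_tauE.
pose m k := freud_phi (lam + k%:R).
have dm k : is_derive t 1 (m k) (m k.+1 t).
  rewrite /m -natr1 addrA; apply: is_derive_freud_phi.
  by rewrite ltr_wpDr.
exact: (@is_derive_det_hankel _ m t P g n dm P_monic size_P moments_orth).
Qed.

End FreudTau.

Lemma is_derive_ln_div (R : realType) (f g : R -> R) (a b t : R) :
  0 < f t -> 0 < g t ->
  is_derive t 1 f (a * f t) -> is_derive t 1 g (b * g t) ->
  is_derive t 1 (fun s => ln (f s / g s)) (a - b).
Proof.
move=> f0 g0 df dg.
have dV := is_deriveV (lt0r_neq0 g0) dg.
have dq := is_deriveM df dV.
have fg0 : 0 < f t / g t by rewrite divr_gt0.
have dln := @is_derive1_comp R (@ln R) (fun s => f s / g s) t _ _ (is_derive1_ln fg0) dq.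
move/is_derive_eq : dln; apply.
rewrite /GRing.scale /=; field.
by rewrite !gt_eqF.
Qed.

Theorem lemma4p3 (R : realType) (lam t : R) (S : nat -> {poly R})
    (beta : nat -> R)
    (hlam : -1 < lam)
    (hS : monic_orthogonal_polys (freud_weight lam t) S)
    (hbeta : forall n : nat, 'X * S n = S n.+1 + beta n *: poly_pred S n)
    (hbeta0 : beta 0%N = 0) :
  (forall n : nat,
     [/\ 0 < freud_tau n (lam + 1) t / freud_tau n lam t,
         is_derive t 1
           (fun s : R => ln (freud_tau n (lam + 1) s / freud_tau n lam s))
           (beta (2 * n)%N),
         0 < freud_tau n.+1 lam t / freud_tau n (lam + 1) t &
         is_derive t 1
           (fun s : R => ln (freud_tau n.+1 lam s / freud_tau n (lam + 1) s))
           (beta (2 * n + 1)%N)]) /\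
  freud_phi lam t =
    euler_gamma (lam + 1) / 2 `^ ((lam + 1) / 2) * expR (t ^+ 2 / 8) *
    parabolic_cylinder (- lam - 1) (- (Num.sqrt 2 * t / 2)).
Proof.
split; last exact: freud_phi_parabolic_cylinder.
have [S_all [h [h0 S_orth]]] := hS.
have S_monic n : S n \is monic by have [] := S_all n.
have size_S n : size (S n) = n.+1 by have [] := S_all n.
have hlam1 : -1 < lam + 1 by lra.
pose P n := even_poly (S n.*2); pose Q n := odd_poly (S n.*2.+1).
have P_monic : forall n, P n \is monic := even_part_monic S_monic size_S.
have Q_monic : forall n, Q n \is monic := odd_part_monic S_monic size_S.
have size_P : forall n, size (P n) = n.+1 := size_even_part size_S.
have size_Q : forall n, size (Q n) = n.+1 := size_odd_part size_S.
have P_orth m n : \int[@lebesgue_measure R]_x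
    ((P m).[x ^+ 2] * (P n).[x ^+ 2] * freud_weight lam t x)
    = h m.*2 * (m == n)%:R.
  rewrite -(inj_eq double_inj) eq_sym -S_orth; apply: eq_Rintegral => x _.
  by rewrite !(horner_even_part size_S hbeta).
have Q_orth m n : \int[@lebesgue_measure R]_x
    ((Q m).[x ^+ 2] * (Q n).[x ^+ 2] * freud_weight (lam + 1) t x)
    = h m.*2.+1 * (m == n)%:R.
  (* The two factors [x] of [S_(2m+1)] and [S_(2n+1)] raise [lam] by one. *)
  rewrite -(inj_eq double_inj) -eqSS eq_sym -S_orth.
  apply: eq_Rintegral => x _; rewrite !(horner_odd_part size_S hbeta).
  have := exprM_freud_weight 1 t x hlam; rewrite expr1 => <-.
  by rewrite /Q; ring.
have tauP n := freud_tau_gt0 hlam P_monic size_P (fun n => h0 n.*2) P_orth n.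
have tauQ n := freud_tau_gt0 hlam1 Q_monic size_Q (fun n => h0 n.*2.+1) Q_orth n.
have dtauP n := is_derive_freud_tau hlam P_monic size_P P_orth n.
have dtauQ n := is_derive_freud_tau hlam1 Q_monic size_Q Q_orth n.
move=> n; split.
- exact: divr_gt0.
- have -> : beta (2 * n)%N = - ('X * Q n)`_n - - ('X * P n)`_n.
    by rewrite opprK addrC mul2n (beta_even S_monic size_S hbeta n hbeta0).
  exact: (is_derive_ln_div (tauQ n) (tauP n) (dtauQ n) (dtauP n)).
- exact: divr_gt0.
- have -> : beta (2 * n + 1)%N = - ('X * P n.+1)`_n.+1 - - ('X * Q n)`_n.
    by rewrite opprK addrC addn1 mul2n (beta_odd S_monic size_S hbeta n).
  exact: (is_derive_ln_div (tauP n.+1) (tauQ n) (dtauP n.+1) (dtauQ n)).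
Qed.
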